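(* Let $S$ be a strictly proper scoring rule. Assume (1) prior identifiability: for every $\pi\in\Lambda$, for $m^\pi$-almost every $x\in\mathcal{X}$ the map $a\mapsto\Pi_x^a$ is injective on $\Lambda$; and (2) there exists $\pi_m\in\Lambda$ which is least favorable with respect to the prior disclosure game with score $S$. If a decision rule $\delta$ is minimax in the disclosure game, then for all Bayesimax priors $\pi$ (for $S$), $\delta(x)=\pi$ for $m^\pi$-almost every $x$.
   Context: Setting. $(\Omega,\mathcal{T})$ is a standard Borel parameter space; $\{P_\theta:\theta\in\Omega\}$ is a family of probability measures on a measurable space $(\mathcal{X},\mathcal{A})$ dominated by a $\sigma$-finite measure $\lambda$, with densities $p_\theta=dP_\theta/d\lambda$. $\Lambda$ is a set of probability measures on $(\Omega,\mathcal{T})$ (priors), with the weak topology and its Borel $\sigma$-algebra. For a prior $\pi$, the prior predictive $m^\pi$ is the measure on $\mathcal{X}$ with $\frac{dm^\pi}{d\lambda}(x)=\int_\Omega p_\theta(x)\,d\pi(\theta)$, and $\Pi_x^\pi$ is the Bayes posterior on $\Omega$ given $X=x$, assumed to exist for $m^\pi$-almost all $x$ and to be measurable in $x$. Scores. A scoring rule $S$ assigns to each probability measure $Q$ on $(\Omega,\mathcal{T})$ a measurable function $S(Q,\cdot):\Omega\to\mathbb{R}\cup\{-\infty\}$. It is proper if $\mathbb{E}_{Y\sim P}[S(P,Y)]\ge\mathbb{E}_{Y\sim P}[S(Q,Y)]$ for all $P,Q$, and strictly proper if in addition equality implies $Q=P$. Prior disclosure game. A decision rule is a measurable map $\delta:\mathcal{X}\to\Lambda$.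 The loss is $\ell_S(\theta,x,a)=-S(\Pi_x^a,\theta)$ for $a\in\Lambda$. The frequentist risk is $\mathcal{R}_S(\delta,\theta)=\mathbb{E}_{X\sim P_\theta}[\ell_S(\theta,X,\delta(X))]$. The Bayes risk under $\pi\in\Lambda$ is $$R_S(\delta,\pi)=\mathbb{E}_{\Theta\sim\pi}[\mathcal{R}_S(\delta,\Theta)]=-\mathbb{E}_{X\sim m^\pi}\Big[\mathbb{E}_{\Theta\sim\Pi_X^\pi}\big[S(\Pi_X^{\delta(X)},\Theta)\big]\Big].$$ The minimum Bayes risk is $r_S(\pi)=\inf_\delta R_S(\delta,\pi)$ over all decision rules, and $\delta$ is a Bayes rule under $\pi$ if $R_S(\delta,\pi)=r_S(\pi)$. A rule $\delta^M$ is minimax if $\sup_{\theta\in\Omega}\mathcal{R}_S(\delta^M,\theta)=\inf_\delta\sup_{\theta\in\Omega}\mathcal{R}_S(\delta,\theta)$. A prior $\pi$ is least favorable if it admits a Bayes rule $\delta_\pi$ such that $\mathcal{R}_S(\delta_\pi,\theta)\le r_S(\pi)$ for all $\theta\in\Omega$. A Bayesimax prior (for $S$) is any maximizer $\pi^\star\in\arg\max_{\pi\in\Lambda}r_S(\pi)$. Conventions. The posteriors $\Pi_x^a$ appearing in these definitions and in the identifiability condition are assumed to exist; risks and the expectations defining them are measurable, well defined and finite. *)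

(* Defs.v *)
From HB Require Import structures.
From mathcomp Require Import all_boot all_order all_algebra.
From mathcomp Require Import all_classical all_reals all_analysis.
From mathcomp Require Import measurable_realfun.

Set Implicit Arguments.
Unset Strict Implicit.
Unset Printing Implicit Defensive.

Import Order.TTheory GRing.Theory Num.Theory.
Import numFieldNormedType.Exports.

Local Open Scope classical_set_scope.
Local Open Scope ring_scope.

(* A standard Borel space is a set with the Borel sigma-algebra of a Polish
   topology. The topology is kept as data, because the weak topology on
   probability measures refers to it; it comes with a complete metric, as a
   [completePseudoMetricType] satisfying [polish]. *)
Notation borel T := (g_sigma_algebraType (@open T)).

Definition polish (R : realType) (T : completePseudoMetricType R) : Prop :=
  hausdorff_space T /\ exists2 D : set T, countable D & dense D.

Section weak_topology.
Context (R : realType) (T : completePseudoMetricType R).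

Definition bounded_continuous : set (T -> R) :=
  [set f | continuous f /\ bounded_fun f].

Definition integrate_bounded_continuous (Q : probability (borel T) R) :
    {ptws bounded_continuous -> R} :=
  fun f => \int[Q]_t \val f t.

(* The coarsest topology on probability measures for which Q |-> \int f dQ is
   continuous for every bounded continuous f. *)
Definition weak_probability : ptopologicalType :=
  initial_topology integrate_bounded_continuous.

End weak_topology.

Section scoring_rules.
Local Open Scope ereal_scope.
Context (R : realType) (d : measure_display) (Omega : measurableType d).
Implicit Type S : probability Omega R -> Omega -> \bar R.

Definition scoring_rule S : Prop :=
  forall Q, measurable_fun setT (S Q) /\ forall theta, S Q theta != +oo.

Definition proper S : Prop :=
  forall P Q : probability Omega R,
    \int[P]_y S Q y <= \int[P]_y S P y.

Definition strictly_proper S : Prop :=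
  proper S /\
  forall P Q : probability Omega R,
    \int[P]_y S P y = \int[P]_y S Q y -> Q = P.

End scoring_rules.

Section dominated_models.
Local Open Scope ereal_scope.
Context (R : realType) (d dX : measure_display).
Context (Omega : measurableType d) (X : measurableType dX).
Implicit Types (P : Omega -> probability X R) (p : Omega -> X -> R).
Implicit Types (lambda : {sigma_finite_measure set X -> \bar R}).
Implicit Types (pi : probability Omega R).

(* Joint measurability of the density is what makes theta |-> P theta a kernel
   and the mixture density below measurable. *)
Definition dominated_model lambda P p : Prop :=
  [/\ forall theta x, (0 <= p theta x)%R,
      measurable_fun setT (fun z : Omega * X => p z.1 z.2) &
      forall theta (A : set X), measurable A ->
        P theta A = \int[lambda]_(x in A) (p theta x)%:E].

Definition prior_predictive lambda p pi : set X -> \bar R :=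
  fun A => \int[lambda]_(x in A) \int[pi]_theta (p theta x)%:E.

(* K is a (version of the) conditional distribution of Theta given X = x when
   Theta ~ pi and X ~ P Theta; it is total, with arbitrary values on a null
   set where the posterior is not determined. *)
Definition is_posterior lambda P p pi (K : X -> probability Omega R) : Prop :=
  measurable_fun setT (K : X -> pprobability Omega R) /\
  forall (A : set X) (B : set Omega), measurable A -> measurable B ->
    \int[prior_predictive lambda p pi]_(x in A) K x B =
    \int[pi]_(theta in B) P theta A.

End dominated_models.

Section prior_disclosure_game.
Local Open Scope ereal_scope.
Context (R : realType) (T : completePseudoMetricType R).
Context (dX : measure_display) (X : measurableType dX).
Local Notation Omega := (borel T).
Local Notation prior := (probability Omega R).
Variables (lambda : {sigma_finite_measure set X -> \bar R}).
Variables (P : Omega -> probability X R) (p : Omega -> X -> R).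
Variables (Lambda : set prior).
(* [Pi a x] is the posterior at x under the prior a. *)
Variables (Pi : prior -> X -> prior) (S : prior -> Omega -> \bar R).

(* Measurable for the Borel sigma-algebra of the weak topology; since that of
   the subspace Lambda is its trace, this is measurability of X -> Lambda. *)
Definition decision_rule : set (X -> prior) :=
  [set delta | (forall x, Lambda (delta x)) /\
    measurable_fun setT (delta : X -> borel (weak_probability T))].

Definition loss (theta : Omega) (x : X) (a : prior) : \bar R :=
  - S (Pi a x) theta.

Definition risk (delta : X -> prior) (theta : Omega) : \bar R :=
  \int[P theta]_x loss theta x (delta x).

Definition bayes_risk (delta : X -> prior) (pi : prior) : \bar R :=
  \int[pi]_theta risk delta theta.

Definition min_bayes_risk (pi : prior) : \bar R :=
  ereal_inf [set bayes_risk delta pi | delta in decision_rule].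

Definition bayes_rule (pi : prior) (delta : X -> prior) : Prop :=
  decision_rule delta /\ bayes_risk delta pi = min_bayes_risk pi.

Definition worst_risk (delta : X -> prior) : \bar R :=
  ereal_sup [set risk delta theta | theta in [set: Omega]].

Definition minimax (delta : X -> prior) : Prop :=
  decision_rule delta /\
  worst_risk delta = ereal_inf [set worst_risk delta' | delta' in decision_rule].

Definition least_favorable (pi : prior) : Prop :=
  Lambda pi /\
  exists2 delta, bayes_rule pi delta &
    forall theta, risk delta theta <= min_bayes_risk pi.

Definition bayesimax (pi : prior) : Prop :=
  Lambda pi /\
  forall pi', Lambda pi' -> min_bayes_risk pi' <= min_bayes_risk pi.

Definition prior_identifiable : Prop :=
  forall pi, Lambda pi ->
    {ae prior_predictive lambda p pi, forall x, set_inj Lambda (Pi ^~ x)}.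

(* The measurability and finiteness conventions for the expectations under
   X ~ P theta, Theta ~ pi and Theta ~ Pi pi x. *)
Definition regular_risks : Prop :=
  forall delta, decision_rule delta ->
  [/\ measurable_fun setT
        (fun z : Omega * X => loss z.1 z.2 (delta z.2)),
      forall theta, (P theta).-integrable setT
        (fun x => loss theta x (delta x)) &
      forall pi, Lambda pi ->
        pi.-integrable setT (risk delta) /\
        {ae prior_predictive lambda p pi, forall x,
          (Pi pi x).-integrable setT (S (Pi (delta x) x))}].

End prior_disclosure_game.

(* Main.v *)
Require Import Defs.
From HB Require Import structures.
From mathcomp Require Import all_boot all_order all_algebra.
From mathcomp Require Import all_classical all_reals all_analysis.
From mathcomp Require Import measurable_realfun giry.

(** Write [m] for the prior predictive of a Bayesimax prior [pi] and [D a x]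
    for the posterior expected loss [\int[Pi pi x] loss _ x a].

    A minimax rule [delta] is Bayes under [pi] ([minimax_bayes_rule]): its risk
    is everywhere at most the worst risk of the Bayes rule attached to a least
    favorable prior [pi_m], hence at most the minimum Bayes risk of [pi_m],
    which is at most that of [pi] by maximality. Averaging a bound valid for
    every parameter gives a bound for the Bayes risk of [delta] under [pi].

    By propriety, [D pi x <= D (delta x) x] for almost all [x], so the rule that
    always reports [pi] does at least as well pointwise. Since [delta] is Bayes,
    equality should hold almost everywhere; strict propriety then gives
    [Pi (delta x) x = Pi pi x], and identifiability gives [delta x = pi].

    The delicate point is the passage from Bayes risks, which integrate over
    [X ~ P theta] and then over [theta ~ pi], to integrals of [D] against [m].
    The two orders of integration agree for functions integrable under the joint
    law ([disintegration]), but the finiteness of the risks only bounds iterated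
    integrals of signed functions, so the loss of [delta] may fail to be jointly
    integrable. The comparison is therefore localized ([local_optimality]): on
    the set [A n] of those [x] where the posterior integral of the absolute
    losses is at most [n], the losses are jointly integrable. The rule that
    reports [pi] on [A n] and follows [delta] elsewhere is a decision rule, so
    it cannot beat [delta]; cancelling the common part outside [A n] yields
    [\int[m]_(x in A n) D (delta x) x <= \int[m]_(x in A n) D pi x], and hence
    equality almost everywhere on [A n]. Almost every [x] is in some [A n]. *)

Set Implicit Arguments.
Unset Strict Implicit.
Unset Printing Implicit Defensive.
Import Order.TTheory GRing.Theory Num.Theory.
Local Open Scope classical_set_scope.
Local Open Scope ring_scope.

(** * Joint law of a probability and a Markov kernel *)

Section joint_law.
Local Open Scope ereal_scope.
Context (R : realType) (d1 d2 : measure_display).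
Context (Y : measurableType d1) (Z : measurableType d2).

Lemma measurable_pprobability (k : Y -> pprobability Z R) :
  (forall A, measurable A -> measurable_fun setT (fun y => k y A)) ->
  measurable_fun setT k.
Proof.
move=> mk; apply: (@measurability _ _ _ _ setT k (@pset _ Z R)) => //.
move=> _ [_ [r r01 [A mA <-]] <-].
rewrite (_ : setT `&` k @^-1` mset A r = [set: Y] `&` [set y | k y A < r%:E])//.
by apply: measurable_lte => //; exact: mk.
Qed.

Variables (mu : probability Y R) (k : Y -> pprobability Z R).
Hypothesis mk : measurable_fun setT k.

(** The law of [(y, z)] with [z ~ k y] and [y] fixed: averaging it over
    [y ~ mu] gives the joint law. As a map into the Giry monad, its bind with
    [mu] comes with the formula for iterated integrals. *)
Definition kernel_graph (y : Y) : giry (Y * Z)%type R :=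
  giry_map (pair1_measurable y) (k y : probability Z R).

Lemma measurable_kernel_graph : measurable_fun setT kernel_graph.
Proof.
apply: measurable_giry_codensity => // B mB.
have := (@measurable_fun_xsection_finite_kernel _ _ Y Z R (kprobability mk) B).
rewrite inE => /(_ mB); apply: eq_measurable_fun => y _.
by rewrite /kernel_graph /giry_map /= /pushforward xsectionE.
Qed.

Definition joint_law : giry (Y * Z)%type R :=
  giry_bind mu measurable_kernel_graph.

Lemma integral_joint_law (f : Y * Z -> \bar R) :
  measurable_fun setT f -> (forall z, 0 <= f z) ->
  \int[joint_law]_w f w = \int[mu]_y \int[k y]_z f (y, z).
Proof.
move=> mf f0; rewrite [LHS]giry_int_bind//; apply: eq_integral => y _.
by rewrite giry_int_map.
Qed.

Lemma joint_law_rectangle (A : set Y) (B : set Z) :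
  measurable A -> measurable B ->
  joint_law (A `*` B) = \int[mu]_(y in A) k y B.
Proof.
move=> mA mB.
have mAB : measurable (A `*` B) by exact: measurableX.
transitivity (\int[joint_law]_w (\1_(A `*` B) w)%:E).
  by rewrite integral_indic// setIT.
rewrite integral_joint_law//; last exact/measurable_EFinP/measurable_indic.
rewrite [RHS]integral_mkcond; apply: eq_integral => y _.
transitivity (\int[k y]_z ((\1_A y)%:E * (\1_B z)%:E)).
  apply: eq_integral => z _.
  by rewrite -EFinM !indicE in_setX/= -natrM mulnb.
rewrite ge0_integralZl//; last exact/measurable_EFinP/measurable_indic.
rewrite integral_indic// setIT patchE indicE.
by case: ifP => yA; rewrite ?mul1e ?mul0e.
Qed.

End joint_law.

Lemma measurable_fun_integral_section (R : realType) (d1 d2 : measure_display)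
    (Y : measurableType d1) (Z : measurableType d2)
    (K : Z -> pprobability Y R) (f : Y * Z -> \bar R) :
  measurable_fun setT K -> measurable_fun setT f -> (forall w, 0 <= f w)%E ->
  measurable_fun setT (fun z => \int[K z]_y f (y, z))%E.
Proof.
move=> mK mf f0; apply: (measurable_fun_integral_finite_kernel
  (fun w : Z * Y => f (w.2, w.1)) (kprobability mK)) => //.
by apply: (measurableT_comp mf); exact: measurable_swap.
Qed.

(** * Exchanging the order of integration *)

Section disintegration.
Local Open Scope ereal_scope.
Context (R : realType) (d1 d2 : measure_display).
Context (Y : measurableType d1) (Z : measurableType d2).
Variables (mu : probability Y R) (k : Y -> pprobability Z R).
Variables (nu : probability Z R) (K : Z -> pprobability Y R).
Hypotheses (mk : measurable_fun setT k) (mK : measurable_fun setT K).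
(* Bayes' theorem on rectangles: [(mu, k)] and [(nu, K)] are the two
   factorizations of one joint law. *)
Hypothesis disintegrate : forall (A : set Y) (B : set Z),
  measurable A -> measurable B ->
  \int[nu]_(z in B) K z A = \int[mu]_(y in A) k y B.

(** Rectangles generate the product sigma-algebra and are stable under
    intersection, so agreement on them is agreement everywhere. *)
Lemma joint_law_swap (C : set (Y * Z)) : measurable C ->
  joint_law mu mk C = giry_map (@measurable_swap _ _ Z Y) (joint_law nu mK) C.
Proof.
pose G := [set A `*` B | A in measurable & B in measurable] : set (set (Y * Z)).
move=> mC.
apply: (measure_unique G (fun=> setT)) => //.
- by rewrite measurable_prod_measurableType.
- move=> _ _ [A1 mA1 [B1 mB1 <-]] [A2 mA2 [B2 mB2 <-]].
  exists (A1 `&` A2); first exact: measurableI.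
  exists (B1 `&` B2); first exact: measurableI.
  by rewrite setXI.
- by move=> _; exists setT => //; exists setT => //; rewrite setXTT.
- by apply/seteqP; split=> // z _; exists 0%N.
- move=> _ [A mA [B mB <-]].
  transitivity (joint_law nu mK (B `*` A)).
    rewrite [RHS]joint_law_rectangle// disintegrate//.
    exact: joint_law_rectangle.
  rewrite (_ : B `*` A = [set w | (A `*` B) (w.2, w.1)])//.
  by apply/seteqP; split=> -[z y] [].
- move=> _; rewrite (@le_lt_trans _ _ 1)// ?ltry//.
  exact: sprobability_setT.
Qed.

Lemma ge0_disintegration (f : Y * Z -> \bar R) :
  measurable_fun setT f -> (forall w, 0 <= f w) ->
  \int[mu]_y \int[k y]_z f (y, z) = \int[nu]_z \int[K z]_y f (y, z).
Proof.
move=> mf f0.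
rewrite -(integral_joint_law mu mk)//.
rewrite (eq_measure_integral
  (giry_map (@measurable_swap _ _ Z Y) (joint_law nu mK))).
  rewrite [LHS](@giry_int_map _ _ _ _ _ _ (@measurable_swap _ _ Z Y))//.
  rewrite [LHS]integral_joint_law//.
    by apply: (measurableT_comp mf); exact: measurable_swap.
  by move=> w; exact: f0.
by move=> C mC _; exact: joint_law_swap.
Qed.

(** Positive and negative parts are exchanged separately; both have finite
    integral because they are dominated by the absolute value. *)
Lemma disintegration (f : Y * Z -> \bar R) :
  measurable_fun setT f -> \int[nu]_z \int[K z]_y `|f (y, z)| < +oo ->
  [/\ mu.-integrable setT (fun y => \int[k y]_z f (y, z)),
      nu.-integrable setT (fun z => \int[K z]_y f (y, z)) &
      \int[mu]_y \int[k y]_z f (y, z) = \int[nu]_z \int[K z]_y f (y, z)].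
Proof.
move=> mf foo.
have mabs : measurable_fun setT (fun w => `|f w|) by exact: measurableT_comp.
have part (g : Y * Z -> \bar R) : measurable_fun setT g ->
    (forall w, 0 <= g w) -> (forall w, g w <= `|f w|) ->
    mu.-integrable setT (fun y => \int[k y]_z g (y, z)) /\
    nu.-integrable setT (fun z => \int[K z]_y g (y, z)).
  move=> mg g0 gf.
  have mgk : measurable_fun setT (fun y => \int[k y]_z g (y, z)).
    exact: (measurable_fun_integral_finite_kernel g (kprobability mk)).
  have mgK : measurable_fun setT (fun z => \int[K z]_y g (y, z)).
    exact: measurable_fun_integral_section.
  have goo : \int[nu]_z \int[K z]_y g (y, z) < +oo.
    apply: le_lt_trans foo; apply: ge0_le_integral => //.
    - by move=> z _; exact: integral_ge0.
    - exact: (measurable_fun_integral_section mK mabs).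
    - move=> z _; apply: ge0_le_integral => //.
      + by apply: measurable_fun_pair1.
      + by apply: (@measurable_fun_pair1 _ _ _ _ _ _ (fun w => `|f w|)).
  split; apply/integrableP; split => //.
  - under eq_integral do rewrite gee0_abs ?integral_ge0//.
    by rewrite ge0_disintegration.
  - by under eq_integral do rewrite gee0_abs ?integral_ge0//.
have mp : measurable_fun setT f^\+ by exact: measurable_funepos.
have mn : measurable_fun setT f^\- by exact: measurable_funeneg.
have p0 w : 0 <= f^\+ w by rewrite funepos_ge0.
have n0 w : 0 <= f^\- w by rewrite funeneg_ge0.
have [|ipk ipK] := part _ mp p0.
  by move=> w; rewrite funeposE ge_max lee_abs abse_ge0.
have [|ink inK] := part _ mn n0.
  by move=> w; rewrite funenegE ge_max -(abseN (f w)) lee_abs abse_ge0.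
have Ek : (fun y => \int[k y]_z f (y, z)) =
    (fun y => \int[k y]_z f^\+ (y, z)) \- (fun y => \int[k y]_z f^\- (y, z)).
  apply/funext => y; rewrite integralE.
  by congr (_ - _); apply: eq_integral => z _; rewrite ?(funeposE, funenegE).
have EK : (fun z => \int[K z]_y f (y, z)) =
    (fun z => \int[K z]_y f^\+ (y, z)) \- (fun z => \int[K z]_y f^\- (y, z)).
  apply/funext => z; rewrite integralE.
  by congr (_ - _); apply: eq_integral => y _; rewrite ?(funeposE, funenegE).
rewrite Ek EK; split; [exact: integrableB|exact: integrableB|].
rewrite [LHS]integralB// [RHS]integralB//.
by rewrite (ge0_disintegration mp p0) (ge0_disintegration mn n0).
Qed.

End disintegration.

(** * Pointwise comparison from comparison of integrals *)

Section ae_eq_of_le.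
Local Open Scope ereal_scope.
Context (R : realType) (d : measure_display) (T : measurableType d).
Variable mu : {measure set T -> \bar R}.

(** [v - u] is almost everywhere nonnegative with integral at most zero. *)
Lemma integral_le_ae_eq (u v : T -> \bar R) :
  mu.-integrable setT u -> mu.-integrable setT v ->
  {ae mu, forall x, u x <= v x} ->
  \int[mu]_x v x <= \int[mu]_x u x ->
  {ae mu, forall x, u x = v x}.
Proof.
move=> iu iv uv vu.
have iw : mu.-integrable setT (v \- u) by exact: integrableB.
have fu := integrable_ae measurableT iu.
have fv := integrable_ae measurableT iv.
have mw := measurable_int _ iw.
have /(ae_eq_integral_abs mu measurableT mw) w0 : \int[mu]_x `|(v \- u) x| = 0.
  apply/eqP; rewrite eq_le integral_ge0// andbT.
  rewrite (@ae_eq_integral _ _ _ mu setT (v \- u))//; first last.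
  - near=> x => _; rewrite gee0_abs// sube_ge0.
      by near: x.
    by apply/orP; left; near: x; apply: filterS fu => x; exact.
  - exact: measurableT_comp.
  by rewrite integralB// lee_subel_addl ?integrable_fin_num// adde0.
near=> x.
have : v x - u x = 0 by near: x; apply: filterS w0 => x /(_ I).
have : v x \is a fin_num by near: x; apply: filterS fv => x; exact.
have : u x \is a fin_num by near: x; apply: filterS fu => x; exact.
move: (u x) (v x) => [a| |] [b| |]//= _ _ /eqP.
by rewrite -EFinB eqe subr_eq0 => /eqP ->.
Unshelve. all: by end_near. Qed.

End ae_eq_of_le.

(** * Localized comparison of two losses *)

Lemma measurable_fun_if_mem (d1 d2 : measure_display)
    (T1 : measurableType d1) (T2 : measurableType d2)
    (A : set T1) (f g : T1 -> T2) :
  measurable A -> measurable_fun setT f -> measurable_fun setT g ->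
  measurable_fun setT (fun x => if x \in A then f x else g x).
Proof.
move=> mA mf mg; rewrite -(setUv A); apply/measurable_funU => //.
  exact: measurableC.
split.
  apply: (eq_measurable_fun f); last exact: measurable_funTS.
  by move=> x ->.
apply: (eq_measurable_fun g); last exact: measurable_funTS.
by move=> x; rewrite in_setC => /negbTE ->.
Qed.

Section local_optimality.
Local Open Scope ereal_scope.
Context (R : realType) (d1 d2 : measure_display).
Context (Y : measurableType d1) (Z : measurableType d2).
Variables (mu : probability Y R) (k : Y -> pprobability Z R).
Variables (nu : probability Z R) (K : Z -> pprobability Y R).
Hypotheses (mk : measurable_fun setT k) (mK : measurable_fun setT K).
Hypothesis disintegrate : forall (A : set Y) (B : set Z),
  measurable A -> measurable B ->
  \int[nu]_(z in B) K z A = \int[mu]_(y in A) k y B.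
Variables f g : Y * Z -> \bar R.
Hypotheses (mf : measurable_fun setT f) (mg : measurable_fun setT g).
Hypothesis kf : forall y, (k y).-integrable setT (fun z => f (y, z)).
Hypothesis mukf : mu.-integrable setT (fun y => \int[k y]_z f (y, z)).
Hypothesis Kf : {ae nu, forall z, (K z).-integrable setT (fun y => f (y, z))}.
Hypothesis Kg : {ae nu, forall z, (K z).-integrable setT (fun y => g (y, z))}.
Hypothesis Kgf : {ae nu, forall z,
  \int[K z]_y g (y, z) <= \int[K z]_y f (y, z)}.
(* Switching from [f] to [g] on a set of second coordinates never helps. *)
Hypothesis optimal : forall A : set Z, measurable A ->
  \int[mu]_y \int[k y]_z f (y, z) <=
  \int[mu]_y \int[k y]_z (if z \in A then g (y, z) else f (y, z)).

(* [abs_mass z] controls both losses: they are jointly integrable over any set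
   on which it is bounded. *)
Let abs_mass z := \int[K z]_y (`|f (y, z)| + `|g (y, z)|).

Let mabs_mass : measurable_fun setT abs_mass.
Proof.
apply: (measurable_fun_integral_section (f := fun w => `|f w| + `|g w|) mK).
  by apply: emeasurable_funD; apply: measurableT_comp.
by move=> w; exact: adde_ge0.
Qed.

(* Since [h] may be restricted to a strip over [A], an integrability bound is
   needed over [A] only. *)
Let restr_disintegration (A : set Z) (h : Y * Z -> \bar R) (r : R) :
  measurable A -> measurable_fun setT h ->
  (forall z, A z -> \int[K z]_y `|h (y, z)| <= r%:E) ->
  [/\ mu.-integrable setT (fun y => \int[k y]_(z in A) h (y, z)),
      nu.-integrable setT ((fun z => \int[K z]_y h (y, z)) \_ A) &
      \int[mu]_y \int[k y]_(z in A) h (y, z) =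
      \int[nu]_z ((fun z => \int[K z]_y h (y, z)) \_ A) z].
Proof.
move=> mA mh hr.
pose hA := h \_ (setT `*` A).
have hAk y : (fun z => hA (y, z)) = (fun z => h (y, z)) \_ A.
  by apply/funext => z; rewrite /hA !patchE in_setX in_setT.
have hAK z : (fun y => hA (y, z)) =
    if z \in A then (fun y => h (y, z)) else cst 0.
  apply/funext => y; rewrite /hA !patchE in_setX in_setT /=.
  by case: ifP.
have mhA : measurable_fun setT hA.
  apply/(measurable_restrictT h (measurableX measurableT mA)).
  exact: measurable_funTS.
have Ek : (fun y => \int[k y]_z hA (y, z)) =
    (fun y => \int[k y]_(z in A) h (y, z)).
  by apply/funext => y; rewrite hAk -integral_mkcond.
have EK : (fun z => \int[K z]_y hA (y, z)) =
    (fun z => \int[K z]_y h (y, z)) \_ A.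
  apply/funext => z; rewrite hAK patchE; case: ifP => // _.
  by rewrite integral0.
rewrite -Ek -EK; apply: (disintegration mk mK disintegrate mhA).
have mabs : measurable_fun setT (fun w => `|hA w|) by exact: measurableT_comp.
(* Outside [A] the inner integral is zero and [r] may be negative, hence the
   absolute value in the bound. *)
apply: (@le_lt_trans _ _ (\int[nu]_z cst `|r|%:E z)); last first.
  by rewrite integral_cst// [X in _ * X]probability_setT mule1 ltry.
apply: ge0_le_integral => //.
- by move=> z _; exact: integral_ge0.
- exact: (measurable_fun_integral_section mK mabs).
- move=> z _; have [Az|Az] := boolP (z \in A); last first.
    rewrite integral0_eq ?lee_fin// => y _.
    by rewrite /hA patchE in_setX (negbTE Az) andbF abse0.
  under eq_integral do rewrite /hA patchE in_setX Az in_setT/=.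
  by apply: (le_trans (hr z _)); [exact: set_mem|rewrite lee_fin ler_norm].
Qed.

(** On a sublevel set [A n] of [abs_mass], joint integrability turns optimality
    into an inequality between integrals of conditional expectations, opposite
    to the pointwise inequality [Kgf]; the sublevel sets exhaust almost all of
    the space. *)
Lemma local_optimality : {ae nu, forall z,
  \int[K z]_y g (y, z) = \int[K z]_y f (y, z)}.
Proof.
pose A n := [set z | abs_mass z <= n%:R%:E].
have mA n : measurable (A n).
  by rewrite /A -[X in measurable X]setTI; exact: measurable_lee.
have An n : {ae nu, forall z, A n z ->
    \int[K z]_y g (y, z) = \int[K z]_y f (y, z)}.
  have fA z : A n z -> \int[K z]_y `|f (y, z)| <= n%:R%:E.
    apply: le_trans; apply: ge0_le_integral => //.
    - exact/measurableT_comp/measurable_fun_pair1.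
    - by apply: emeasurable_funD; exact/measurableT_comp/measurable_fun_pair1.
    - by move=> y _; rewrite leeDl.
  have gA z : A n z -> \int[K z]_y `|g (y, z)| <= n%:R%:E.
    apply: le_trans; apply: ge0_le_integral => //.
    - exact/measurableT_comp/measurable_fun_pair1.
    - by apply: emeasurable_funD; exact/measurableT_comp/measurable_fun_pair1.
    - by move=> y _; rewrite leeDr.
  have [ib iB eB] := restr_disintegration (mA n) mf fA.
  have [ic iC eC] := restr_disintegration (mA n) mg gA.
  (* Common part of the two risks; it is integrable as a difference of
     integrable functions, so it can be cancelled. *)
  pose a y := \int[k y]_(z in ~` A n) f (y, z).
  have split_f y : \int[k y]_z f (y, z) = \int[k y]_(z in A n) f (y, z) + a y.
    rewrite -integral_setU// ?setUv//.
    - exact: measurableC.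
    - exact: measurable_fun_pair2.
    - by apply/disj_set2P; exact: setICr.
  have split_g y : \int[k y]_z (if z \in A n then g (y, z) else f (y, z)) =
      \int[k y]_(z in A n) g (y, z) + a y.
    rewrite -(setUv (A n)) integral_setU//.
    - congr (_ + _); apply: eq_integral => z.
        by move=> ->.
      by rewrite in_setC => /negbTE ->.
    - exact: measurableC.
    - by rewrite setUv; apply: measurable_fun_if_mem => //;
        exact: measurable_fun_pair2.
    - by apply/disj_set2P; exact: setICr.
  have ia : mu.-integrable setT a.
    rewrite (_ : a = (fun y => \int[k y]_z f (y, z)) \-
                     (fun y => \int[k y]_(z in A n) f (y, z))).
      exact: integrableB.
    apply/funext => y; rewrite split_f addeAC subee ?add0e//.
    by apply: integrable_fin_num => //; exact: integrableS (kf y).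
  have : {ae nu, forall z, ((fun z => \int[K z]_y g (y, z)) \_ (A n)) z =
     ((fun z => \int[K z]_y f (y, z)) \_ (A n)) z}.
    apply: integral_le_ae_eq => //.
      by apply: filterS Kgf => z gf; rewrite !patchE; case: ifP.
    rewrite -eB -eC.
    have := optimal (mA n).
    under eq_integral do rewrite split_f.
    under [X in _ <= X -> _]eq_integral do rewrite split_g.
    rewrite (integralD measurableT ib ia) (integralD measurableT ic ia).
    by rewrite leeD2rE// integrable_fin_num.
  by apply: filterS => z; rewrite !patchE => + Az; rewrite mem_set.
have Kfoo : {ae nu, forall z, abs_mass z < +oo}.
  apply: filterS2 Kf Kg => z fz gz.
  rewrite /abs_mass ge0_integralD//; last 2 first.
  - exact/measurableT_comp/measurable_fun_pair1.
  - exact/measurableT_comp/measurable_fun_pair1.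
  by apply: lte_add_pinfty; [case/integrableP: fz|case/integrableP: gz].
have : {ae nu, forall z, forall n, A n z ->
    \int[K z]_y g (y, z) = \int[K z]_y f (y, z)}.
  by apply/ae_foralln.
apply: filterS2 Kfoo => z zoo; apply.
have s0 : 0 <= abs_mass z by apply: integral_ge0 => y _; exact: adde_ge0.
have sfin : abs_mass z \is a fin_num by rewrite ge0_fin_numE.
apply: (_ : A (Num.bound (fine (abs_mass z))) z).
rewrite /A/= -{1}(fineK sfin) lee_fin ltW// archi_boundP//.
exact: fine_ge0.
Qed.
End local_optimality.

(** * The model and its prior predictive law *)

Lemma integral_le_ub (R : realType) (d : measure_display)
    (T : measurableType d) (mu : probability T R) (f : T -> \bar R)
    (r : \bar R) :
  mu.-integrable setT f -> (forall x, f x <= r)%E -> (\int[mu]_x f x <= r)%E.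
Proof.
move=> fi fr; have -> : r = (\int[mu]_x cst r x)%E.
  by rewrite integral_cst// [X in (_ * X)%E]probability_setT mule1.
case: r fr => [r| |] fr.
- by apply: le_integral => //; exact: finite_measure_integrable_cst.
- by rewrite integral_cst// [X in (_ * X)%E]probability_setT mule1 leey.
- rewrite le_eqVlt; apply/orP; left; apply/eqP; apply: eq_integral => x _.
  by apply/eqP; rewrite -leeNy_eq.
Qed.

Section dominated_model_theory.
Local Open Scope ereal_scope.
Context (R : realType) (d dX : measure_display).
Context (Omega : measurableType d) (X : measurableType dX).
Variables (lambda : {sigma_finite_measure set X -> \bar R}).
Variables (P : Omega -> probability X R) (p : Omega -> X -> R).
Hypothesis model : dominated_model lambda P p.

Lemma dominated_model_kernel :
  measurable_fun setT (P : Omega -> pprobability X R).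
Proof.
have [p0 mp Pp] := model.
apply: measurable_pprobability => A mA.
pose pA (z : Omega * X) := ((fun z => (p z.1 z.2)%:E) \_ (setT `*` A)) z.
have mpA : measurable_fun setT pA.
  apply/(measurable_restrictT _ (measurableX measurableT mA)).
  by apply/measurable_funTS/measurable_EFinP.
have pA0 z : 0 <= pA z by rewrite /pA patchE; case: ifP => //; rewrite lee_fin.
have := measurable_fun_fubini_tonelli_F (m2 := lambda) pA mpA pA0.
apply: eq_measurable_fun => theta _.
rewrite Pp// [RHS]integral_mkcond /fubini_F.
by apply: eq_integral => x _; rewrite /pA !patchE in_setX in_setT.
Qed.

(** The mixture density is nonnegative and measurable by Tonelli, which makes
    the prior predictive a measure; the posterior identity on the whole space
    computes its mass. *)
Lemma prior_predictive_probability (pi : probability Omega R)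
    (K : X -> probability Omega R) :
  is_posterior lambda P p pi K ->
  exists m : probability X R, prior_predictive lambda p pi = m.
Proof.
have [p0 mp Pp] := model.
move=> [mK disint].
pose q x := \int[pi]_theta (p theta x)%:E.
have mq : measurable_fun setT q.
  have mp' : measurable_fun setT (fun z : Omega * X => (p z.1 z.2)%:E).
    exact/measurable_EFinP.
  apply: (measurable_fun_fubini_tonelli_G (m1 := pi) _ mp').
  by move=> z; rewrite lee_fin.
have q0 x : 0 <= q x by apply: integral_ge0 => theta _; rewrite lee_fin.
pose m := prior_predictive lambda p pi.
have m0 : m set0 = 0 by rewrite /m /prior_predictive integral_set0.
have mge0 A : 0 <= m A by apply: integral_ge0 => x _; exact: q0.
have msigma : semi_sigma_additive m.
  exact: (semi_sigma_additive_nng_induced mq q0).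
pose mm : {measure set X -> \bar R} :=
  HB.pack_for {measure set X -> \bar R} m
    (isMeasure.Build _ _ _ m m0 mge0 msigma).
have m1 : mm setT = 1.
  transitivity (\int[mm]_x K x setT).
    rewrite (eq_integral (cst 1)) => [|x _]; last exact: probability_setT.
    by rewrite integral_cst// mul1e.
  rewrite [LHS](disint setT setT)// (eq_integral (cst 1)).
    by rewrite integral_cst// mul1e [LHS]probability_setT.
  by move=> theta _; exact: probability_setT.
by exists (HB.pack_for (probability X R) m mm
  (Measure_isProbability.Build _ _ _ mm m1)).
Qed.

End dominated_model_theory.

(** * Rules in the disclosure game *)

Section bayes_rules.
Local Open Scope ereal_scope.
Context (R : realType) (T : completePseudoMetricType R).
Context (dX : measure_display) (X : measurableType dX).
Variables (P : borel T -> probability X R).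
Variables (Lambda : set (probability (borel T) R)).
Variables (Pi : probability (borel T) R -> X -> probability (borel T) R).
Variables (S : probability (borel T) R -> borel T -> \bar R).

(** Minimum Bayes risks of [pi_m] and [pi] sandwich the risk of [delta]: the
    first bounds it pointwise, the second is maximal and bounds its average
    under [pi] from below. *)
Lemma minimax_bayes_rule (pi_m pi : probability (borel T) R)
    (delta : X -> probability (borel T) R) :
  least_favorable P Lambda Pi S pi_m ->
  minimax P Lambda Pi S delta -> bayesimax P Lambda Pi S pi ->
  pi.-integrable setT (risk P Pi S delta) ->
  bayes_rule P Lambda Pi S pi delta.
Proof.
move=> [Lm [delta_m [ddelta_m _] risk_m]] [ddelta worst] [Lpi pi_max] irisk.
split => //; apply/eqP; rewrite eq_le; apply/andP; split; last first.
  by apply: ereal_inf_lbound; exists delta.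
apply: le_trans (pi_max _ Lm).
have risk_le theta :
    risk P Pi S delta theta <= min_bayes_risk P Lambda Pi S pi_m.
  apply: (@le_trans _ _ (worst_risk P Pi S delta)).
    by apply: ereal_sup_ubound; exists theta.
  rewrite worst; apply: (@le_trans _ _ (worst_risk P Pi S delta_m)).
    by apply: ereal_inf_lbound; exists delta_m.
  by apply: ge_ereal_sup => _ [theta' _ <-].
exact: integral_le_ub.
Qed.

Lemma decision_rule_glue (A : set X)
    (delta delta' : X -> probability (borel T) R) :
  measurable A -> decision_rule Lambda delta -> decision_rule Lambda delta' ->
  decision_rule Lambda (fun x => if x \in A then delta' x else delta x).
Proof.
move=> mA [Ld md] [Ld' md']; split; first by move=> x; case: ifP.
exact: measurable_fun_if_mem.
Qed.

Lemma decision_rule_cst (a : probability (borel T) R) :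
  Lambda a -> decision_rule Lambda ((fun=> a) : X -> probability (borel T) R).
Proof. by move=> La; split => //; exact: measurable_cst. Qed.

End bayes_rules.

Theorem corollary3p8 (R : realType) (T : completePseudoMetricType R)
  (dX : measure_display) (X : measurableType dX)
  (lambda : {sigma_finite_measure set X -> \bar R})
  (P : borel T -> probability X R) (p : borel T -> X -> R)
  (Lambda : set (probability (borel T) R))
  (Pi : probability (borel T) R -> X -> probability (borel T) R)
  (S : probability (borel T) R -> borel T -> \bar R) :
  polish T ->
  dominated_model lambda P p ->
  (forall pi, Lambda pi -> is_posterior lambda P p pi (Pi pi)) ->
  scoring_rule S ->
  strictly_proper S ->
  regular_risks lambda P p Lambda Pi S ->
  prior_identifiable lambda p Lambda Pi ->
  (exists pi_m, least_favorable P Lambda Pi S pi_m) ->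
  forall delta : X -> probability (borel T) R,
    minimax P Lambda Pi S delta ->
    forall pi, bayesimax P Lambda Pi S pi ->
      {ae prior_predictive lambda p pi, forall x, delta x = pi}.
Proof.
move=> _ model post score [prop strict] reg ident [pi_m lf] delta mini pi bmax.
have Lpi := bmax.1; have ddelta := mini.1.
have dpi := decision_rule_cst X Lpi.
have [mf kf /(_ _ Lpi)[irisk Kf]] := reg _ ddelta.
have [mg _ /(_ _ Lpi)[_ Kg]] := reg _ dpi.
have [_ bayes] := minimax_bayes_rule lf mini bmax irisk.
have [mK disint] := post _ Lpi.
have idp := ident _ Lpi.
have [m mE] := prior_predictive_probability model (post _ Lpi).
rewrite mE in Kf Kg idp disint *.
(* Expected loss is minus expected score, wherever the score is integrable. *)
have opp (a : X -> probability (borel T) R) x :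
    (Pi pi x).-integrable setT (S (Pi (a x) x)) ->
    (\int[Pi pi x]_theta loss Pi S theta x (a x) =
     - \int[Pi pi x]_theta S (Pi (a x) x) theta)%E.
  move=> Si; rewrite /loss integralN//.
  by rewrite fin_num_adde_defl// fin_numN integrable_neg_fin_num.
have : {ae m, forall x,
    (\int[Pi pi x]_theta loss Pi S theta x pi =
     \int[Pi pi x]_theta loss Pi S theta x (delta x))%E}.
  apply: (local_optimality (dominated_model_kernel model) mK
    (fun A B mA mB => disint B A mB mA) mf mg) => //.
  - by apply: filterS Kf => x; exact: integrableN.
  - by apply: filterS Kg => x; exact: integrableN.
  - apply: filterS2 Kf Kg => x Kfx Kgx.
    by rewrite (opp delta)// (opp (fun=> pi))// leeN2.
  - move=> A mA; rewrite [leLHS](_ : _ = bayes_risk P Pi S delta pi)// bayes.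
    (* The competitor reports [pi] on [A] and follows [delta] elsewhere. *)
    apply: ereal_inf_lbound; eexists.
      exact: (decision_rule_glue mA ddelta dpi).
    apply: eq_integral => theta _; apply: eq_integral => x _.
    by case: ifP.
move=> Keq; near=> x.
have Kfx : (Pi pi x).-integrable setT (S (Pi (delta x) x)) by near: x.
have Kgx : (Pi pi x).-integrable setT (S (Pi pi x)) by near: x.
have inj : set_inj Lambda (Pi ^~ x) by near: x.
apply: inj; rewrite ?inE//; first exact: ddelta.1.
apply: strict; apply: oppe_inj.
rewrite -(opp delta)// -(opp (fun=> pi))//.
by near: x.
Unshelve. all: by end_near. Qed.
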